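(* Let $A\in\mathbb R^{n\times n}$ be the symmetric positive definite matrix assembled from a conforming finite-element discretization on a mesh $\mathcal T_h$ (a finite set of elements), and assume that $$A=\sum_{T\in\mathcal T_h}R_T^\top A_TR_T,\qquad A_T\succeq0,$$ where, for each element $T\in\mathcal T_h$, $R_T:\mathbb R^n\to\mathbb R^{n_T}$ is the Boolean restriction from the global degrees of freedom $\{1,\dots,n\}$ to the set of $n_T$ degrees of freedom of $T$, and $A_T\in\mathbb R^{n_T\times n_T}$ is symmetric positive semidefinite. For each $T\in\mathcal T_h$, let $G_T\in\mathbb R^{m_T\times n_T}$ be any matrix such that $A_T=G_T^\top G_T$. Let $m=\sum_{T\in\mathcal T_h}m_T$ and let $G\in\mathbb R^{m\times n}$ be the matrix obtained by stacking vertically the blocks $G_TR_T\in\mathbb R^{m_T\times n}$ over all $T\in\mathcal T_h$: $$G=\begin{bmatrix}G_{T_1}R_{T_1}\\ G_{T_2}R_{T_2}\\ \vdots\end{bmatrix}.$$ Then $$A=G^\top G,\qquad\text{and}\qquad \bm u^\top A\bm u=\sum_{T\in\mathcal T_h}\|G_T(R_T\bm u)\|_2^2\quad\text{for all }\bm u\in\mathbb R^n.$$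
   Context: The Boolean restriction to a set $X\subseteq\{1,\dots,n\}$ is the matrix formed by the rows of the $n\times n$ identity matrix indexed by $X$. The only information about the discretization that is used is the stated decomposition of $A$: a finite set $\mathcal T_h$ of elements, for each element $T$ a set of $n_T$ global degree-of-freedom indices contained in $\{1,\dots,n\}$ with associated Boolean restriction $R_T$, and symmetric positive semidefinite element matrices $A_T$. The notation $A_T\succeq0$ means symmetric positive semidefinite. *)

(* Defs.v *)
From HB Require Import structures.
From mathcomp Require Import all_boot all_order all_algebra.
From mathcomp Require Import reals.

Set Implicit Arguments.
Unset Strict Implicit.
Unset Printing Implicit Defensive.

Import Order.TTheory GRing.Theory Num.Theory.
Local Open Scope ring_scope.

Definition qform (R : realType) (n : nat) (A : 'M[R]_n) (x : 'cV[R]_n) : R :=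
  (x^T *m A *m x) 0 0.

Definition is_spd (R : realType) (n : nat) (A : 'M[R]_n) : Prop :=
  A \is symmetricmx /\ forall x : 'cV[R]_n, x != 0 -> 0 < qform A x.

Definition is_spsd (R : realType) (n : nat) (A : 'M[R]_n) : Prop :=
  A \is symmetricmx /\ forall x : 'cV[R]_n, 0 <= qform A x.

(* The norm that MathComp-Analysis puts on matrices is the max norm, so the
   Euclidean norm has to be introduced separately. *)
Definition norm2 (R : realType) (k : nat) (x : 'cV[R]_k) : R :=
  Num.sqrt (\sum_(i < k) x i 0 ^+ 2).

(* The rows come in increasing order of their index in X. *)
Definition boolean_restriction (R : realType) (n : nat) (X : {set 'I_n}) :
    'M[R]_(#|X|, n) :=
  rowsub (fun i : 'I_#|X| => enum_val i) 1%:M.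

Lemma sum_enumeration (Th : finType) (N : nat) (e : 'I_N -> Th)
    (e_bij : bijective e) (m : Th -> nat) :
  (\sum_(k < N) m (e k) = \sum_(T : Th) m T)%N.
Proof. by rewrite [RHS](reindex e) //; exact: onW_bij. Qed.

(* Vertical stacking of the blocks B (e 0), B (e 1), ...; the cast only replaces
   the height of \mxcol, a sum over 'I_N, by the equal sum over Th. *)
Definition stack (R : realType) (Th : finType) (N : nat) (e : 'I_N -> Th)
    (e_bij : bijective e) (m : Th -> nat) (n : nat)
    (B : forall T : Th, 'M[R]_(m T, n)) : 'M[R]_(\sum_(T : Th) m T, n) :=
  castmx (sum_enumeration e_bij m, erefl n) (\mxcol_(k < N) B (e k)).

(* Main.v *)
Require Import Defs.
From HB Require Import structures.
From mathcomp Require Import all_boot all_order all_algebra.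
From mathcomp Require Import reals.

Set Implicit Arguments.
Unset Strict Implicit.
Unset Printing Implicit Defensive.

Import Order.TTheory GRing.Theory Num.Theory.
Local Open Scope ring_scope.

(** The Gram matrix of a vertical stack is the sum of the Gram matrices of its blocks
    ([gram_stack]). For the block [G_T R_T] this Gram matrix is
    [R_T^T G_T^T G_T R_T = R_T^T A_T R_T], so the sum is the assembled [A]. Evaluating each term at
    [u] gives a squared Euclidean norm by [gram_norm2]. *)

Lemma gram_castmx (R : comPzRingType) (p q n : nat) (eq_pq : p = q) (B : 'M[R]_(p, n)) :
  (castmx (eq_pq, erefl n) B)^T *m castmx (eq_pq, erefl n) B = B^T *m B.
Proof. by case: q / eq_pq; rewrite castmx_id. Qed.

(** A block row times a block column is the sum of the blockwise products. The cast affects only the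
    row index, which the product contracts, and [e] turns the sum over positions into one over
    elements. *)
Lemma gram_stack (R : realType) (Th : finType) (N : nat) (e : 'I_N -> Th)
    (e_bij : bijective e) (m : Th -> nat) (n : nat)
    (B : forall T : Th, 'M[R]_(m T, n)) :
  (stack e_bij B)^T *m stack e_bij B = \sum_(T : Th) (B T)^T *m B T.
Proof.
rewrite /stack gram_castmx tr_mxcol mul_mxrow_mxcol [RHS](reindex e) //.
exact: onW_bij.
Qed.

Lemma gram_norm2 (R : realType) (k : nat) (x : 'cV[R]_k) :
  (x^T *m x) 0 0 = norm2 x ^+ 2.
Proof.
rewrite /norm2 sqr_sqrtr; last by apply: sumr_ge0 => i _; apply: sqr_ge0.
by rewrite mxE; apply: eq_bigr => i _; rewrite mxE expr2.
Qed.

Theorem proposition5p1 (R : realType) (n : nat) (A : 'M[R]_n)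
    (Th : finType) (dof : Th -> {set 'I_n})
    (AT : forall T : Th, 'M[R]_#|dof T|)
    (A_spd : is_spd A)
    (AT_spsd : forall T : Th, is_spsd (AT T))
    (A_assembled : A = \sum_(T : Th)
       (boolean_restriction R (dof T))^T *m AT T *m boolean_restriction R (dof T))
    (m : Th -> nat) (GT : forall T : Th, 'M[R]_(m T, #|dof T|))
    (AT_factor : forall T : Th, AT T = (GT T)^T *m GT T)
    (N : nat) (e : 'I_N -> Th) (e_bij : bijective e) :
  let G : 'M[R]_(\sum_(T : Th) m T, n) :=
    stack e_bij (fun T : Th => GT T *m boolean_restriction R (dof T)) in
  A = G^T *m G /\
  forall u : 'cV[R]_n,
    (u^T *m A *m u) 0 0 =
    \sum_(T : Th) norm2 (GT T *m (boolean_restriction R (dof T) *m u)) ^+ 2.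
Proof.
move=> G.
have A_gram : A = \sum_(T : Th) (GT T *m boolean_restriction R (dof T))^T
    *m (GT T *m boolean_restriction R (dof T)).
  by rewrite A_assembled; apply: eq_bigr => T _; rewrite AT_factor trmx_mul !mulmxA.
split=> [|u]; first by rewrite gram_stack.
(* The energy is split element by element from the summed form of [A], without passing through [G];
   each term is the Gram product of the vector [G_T (R_T u)]. *)
rewrite A_gram mulmx_sumr mulmx_suml summxE; apply: eq_bigr => T _.
by rewrite -gram_norm2 !trmx_mul !mulmxA.
Qed.
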